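(* Let $\mathbb{K}$ be a field and let $1\le n\le 10$. (1) (Lists of exponent sets.) The sub-partial-monoids of $[0,n-1]$, together with the values $e_n(E)$, are exactly those given by the following recursive list. For $n=1$ the only one is $\{0\}$, with $e_1=0$. For $2\le n\le 10$ they are the sets $E'\cup\{n-1\}$, where $E'$ runs over the sub-partial-monoids of $[0,n-2]$, with $e_n(E'\cup\{n-1\})=e_{n-1}(E')$, together with the following ones not containing $n-1$ (only the positive elements are listed, written as a string of digits, with $\emptyset$ standing for $E=\{0\}$; the number after the colon is $e_n(E)$): $n=2$: $\emptyset:0$. $n=3$: $\emptyset:0$. $n=4$: $2:1$; $\emptyset:0$. $n=5$: $3:1$; $\emptyset:0$. $n=6$: $34:2$; $24:2$; $4:1$; $3:2$; $\emptyset:0$. $n=7$: $45:2$; $5:1$; $4:2$; $\emptyset:0$. $n=8$: $456:3$; $356:3$; $56:2$; $246:3$; $46:3$; $36:3$; $6:1$; $45:4$; $5:2$; $4:3$; $\emptyset:0$. $n=9$: $567:3$; $367:4$; $67:2$; $57:3$; $7:1$; $56:4$; $36:4$; $6:2$; $5:3$; $\emptyset:0$. $n=10$: $5678:4$; $4678:4$; $678:3$; $578:4$; $478:4$; $78:2$; $568:5$; $2468:4$; $468:5$; $68:3$; $58:4$; $48:4$; $8:1$; $567:6$; $67:4$; $57:5$; $7:2$; $56:6$; $6:3$; $5:4$; $\emptyset:0$. (2) (Lists of subalgebras.) For every sub-partial-monoid $E$ of $[0,n-1]$, with minimal generators $g_1<\dots<g_d$ ($d=d(E)$), the $\mathbb{K}$-subalgebras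 $R\subseteq \mathbb{K}[x]/x^n$ with $E(R)=E$ are exactly the subalgebras generated by $$x^{g_i}+\sum_{h\in[0,n-1]\setminus E,\ h>g_i} c_{i,h}\,x^h,\qquad i=1,\dots,d,$$ with arbitrary parameters $c_{i,h}\in\mathbb{K}$; the number of parameters is $e_n(E)$, and distinct choices of parameters give distinct subalgebras. (For $E=\{0\}$ the only subalgebra is $\mathbb{K}$.) (3) Every $\mathbb{K}$-subalgebra $R\subseteq\mathbb{K}[x]/x^n$, with maximal ideal $\mathfrak{m}$ and exponent set $E=E(R)$, satisfies $\dim_{\mathbb{K}}(\mathfrak{m}/\mathfrak{m}^2)=d(E)$, i.e. all these algebras are thin.
   Context: Subalgebras are unital. For an integer $n\ge 1$, $[0,n-1]=\{0,1,\dots,n-1\}$. A sub-partial-monoid of $[0,n-1]$ is a subset $E$ with $0\in E$ such that $a,b\in E$ and $a+b\le n-1$ imply $a+b\in E$. Put $E_{>0}=E\setminus\{0\}$ and $E^{(2)}=(E_{>0}+E_{>0})\cap[1,n-1]$. The minimal generators of $E$ are the elements of $E_{>0}\setminus E^{(2)}$, and $d(E)=\#(E_{>0}\setminus E^{(2)})$ is the minimal number of generators of $E$. The invariant $e_n(E)$ is defined recursively by $e_1(E)=0$ and, for $n>1$, $e_n(E)=e_{n-1}(E\setminus\{n-1\})$ if $n-1\in E$, and $e_n(E)=d(E)+e_{n-1}(E)$ if $n-1\notin E$. A $\mathbb{K}$-subalgebra $R\subseteq\mathbb{K}[x]/x^n$ is a local ring with maximal ideal $\mathfrak{m}$ (its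 elements with zero constant term). Its exponent set $E(R)\subseteq[0,n-1]$ is the set of $x$-adic valuations of nonzero elements of $R$; it is a sub-partial-monoid of $[0,n-1]$. $R$ is called thin if $\dim_{\mathbb{K}}(\mathfrak{m}/\mathfrak{m}^2)=d(E(R))$, and non-thin otherwise. *)

(* Defs.v *)
From HB Require Import structures.
From mathcomp Require Import all_boot all_order all_algebra all_field.
From mathcomp Require Import boolp.

Set Implicit Arguments.
Unset Strict Implicit.
Unset Printing Implicit Defensive.

Import GRing.Theory.

Section Exponents.

Variable n : nat.
Implicit Type E : {set 'I_n}.

(* The range [0, n-1] is 'I_n: the condition a + b <= n-1 says that a + b is
   the value of some c : 'I_n. *)
Definition sub_partial_monoid E : Prop :=
  (exists2 z : 'I_n, z \in E & z = 0 :> nat) /\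
  (forall a b c : 'I_n, a \in E -> b \in E -> c = a + b :> nat -> c \in E).

Definition positive_part E : {set 'I_n} := [set a in E | 0 < a].

Definition double_part E : {set 'I_n} :=
  [set c : 'I_n | [exists a in positive_part E,
     exists b in positive_part E, c == a + b :> nat]].

Definition min_gens E : {set 'I_n} := positive_part E :\: double_part E.

Definition min_gen_number E : nat := #|min_gens E|.

Definition param_index E (p : 'I_n * 'I_n) : bool :=
  [&& p.1 \in min_gens E, p.2 \notin E & p.1 < p.2].

(* The index set of the coefficients c_{i,h}, with the i-th minimal generator
   g_i used as first index instead of i. *)
Definition param E : predArgType := {p : 'I_n * 'I_n | param_index E p}.

End Exponents.

(* E :&: [0, n-1] for E a subset of [0, n], as a subset of [0, n-1]. *)
Definition drop_max (n : nat) (E : {set 'I_n.+1}) : {set 'I_n} :=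
  [set i | widen_ord (leqnSn n) i \in E].

Definition add_max (n : nat) (E : {set 'I_n}) : {set 'I_n.+1} :=
  ord_max |: [set widen_ord (leqnSn n) i | i in E].

(* At n.+1 the largest element of the range is n = ord_max. *)
Fixpoint e_inv (n : nat) : {set 'I_n} -> nat :=
  match n return {set 'I_n} -> nat with
  | 0 => fun _ => 0
  | n'.+1 => fun E =>
      if n' == 0 then 0
      else if ord_max \in E then e_inv (drop_max E)
      else min_gen_number E + e_inv (drop_max E)
  end.

Definition of_positives (n : nat) (s : seq nat) : {set 'I_n} :=
  [set i : 'I_n | val i \in 0 :: s].

(* The sets not containing n-1 (positive elements only), paired with their
   value of e_inv. *)
Definition exponent_table (n : nat) : seq (seq nat * nat) :=
  match n with
  | 2 => [:: ([::], 0)]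
  | 3 => [:: ([::], 0)]
  | 4 => [:: ([:: 2], 1); ([::], 0)]
  | 5 => [:: ([:: 3], 1); ([::], 0)]
  | 6 => [:: ([:: 3; 4], 2); ([:: 2; 4], 2); ([:: 4], 1); ([:: 3], 2);
             ([::], 0)]
  | 7 => [:: ([:: 4; 5], 2); ([:: 5], 1); ([:: 4], 2); ([::], 0)]
  | 8 => [:: ([:: 4; 5; 6], 3); ([:: 3; 5; 6], 3); ([:: 5; 6], 2);
             ([:: 2; 4; 6], 3); ([:: 4; 6], 3); ([:: 3; 6], 3); ([:: 6], 1);
             ([:: 4; 5], 4); ([:: 5], 2); ([:: 4], 3); ([::], 0)]
  | 9 => [:: ([:: 5; 6; 7], 3); ([:: 3; 6; 7], 4); ([:: 6; 7], 2);
             ([:: 5; 7], 3); ([:: 7], 1); ([:: 5; 6], 4); ([:: 3; 6], 4);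
             ([:: 6], 2); ([:: 5], 3); ([::], 0)]
  | 10 => [:: ([:: 5; 6; 7; 8], 4); ([:: 4; 6; 7; 8], 4); ([:: 6; 7; 8], 3);
              ([:: 5; 7; 8], 4); ([:: 4; 7; 8], 4); ([:: 7; 8], 2);
              ([:: 5; 6; 8], 5); ([:: 2; 4; 6; 8], 4); ([:: 4; 6; 8], 5);
              ([:: 6; 8], 3); ([:: 5; 8], 4); ([:: 4; 8], 4); ([:: 8], 1);
              ([:: 5; 6; 7], 6); ([:: 6; 7], 4); ([:: 5; 7], 5); ([:: 7], 2);
              ([:: 5; 6], 6); ([:: 6], 3); ([:: 5], 4); ([::], 0)]
  | _ => [::]
  end.

(* Meaningful for 1 <= n <= 10 only. *)
Fixpoint exponent_list (n : nat) : seq ({set 'I_n} * nat) :=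
  match n return seq ({set 'I_n} * nat) with
  | 0 => [::]
  | n'.+1 =>
      if n' == 0 then [:: (of_positives n'.+1 [::], 0)]
      else [seq (add_max p.1, p.2) | p <- exponent_list n']
           ++ [seq (of_positives n'.+1 t.1, t.2) | t <- exponent_table n'.+1]
  end.

(* The library declares the vector space and the algebra structures of
   {poly %/ h} separately. *)
HB.instance Definition _ (K : fieldType) (h : {poly K}) :=
  Vector.on {poly %/ h}.

Local Open Scope ring_scope.

(* K[x]/x^n for n >= 1; the class of x is 'qX. *)
Notation truncpoly K n := ({poly %/ ('X^n : {poly K})}).

Section Subalgebras.

Variables (K : fieldType) (n : nat).
Implicit Types (f : truncpoly K n) (R : {vspace truncpoly K n}).

(* {aspace _} does not require that the unit of the subalgebra be 1. *)
Definition unital_subalgebra R : bool := (1 \in R) && (R * R <= R)%VS.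

(* The x-adic valuation of the class of a nonzero polynomial f of degree < n is
   the multiplicity of 0 as a root of f. *)
Definition xval f : nat := mup 0 (f : {poly K}).

Definition exponent_set R : {set 'I_n} :=
  [set i : 'I_n | `[< exists f, [/\ f \in R, f != 0 & xval f = i] >] ].

Definition const_term f : K^o := (f : {poly K})`_0.

Fact const_term_is_linear : linear const_term.
Proof. by move=> a f g; rewrite /const_term /= coefD coefZ. Qed.

HB.instance Definition _ :=
  GRing.isSemilinear.Build K (truncpoly K n) K^o _ const_term
    (GRing.semilinear_linear const_term_is_linear).

Definition max_ideal R : {vspace truncpoly K n} :=
  (R :&: lker (linfun const_term))%VS.

Lemma mem_max_ideal R f :
  (f \in max_ideal R) = (f \in R) && ((f : {poly K})`_0 == 0).
Proof. by rewrite memv_cap memv_ker lfunE. Qed.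

(* \dim (m / m^2); if R is a subalgebra then m^2 is a subspace of m. *)
Definition cotangent_dim R : nat :=
  (\dim (max_ideal R) - \dim (max_ideal R * max_ideal R))%N.

Definition thin R : Prop :=
  cotangent_dim R = min_gen_number (exponent_set R).

Variables (E : {set 'I_n}) (c : {ffun param E -> K}).

(* The pairs p : param E with p.1 = g are the (g, h) with h > g outside E. *)
Definition family_generator (g : 'I_n) : truncpoly K n :=
  'qX ^+ g + \sum_(p : param E | (val p).1 == g) c p *: 'qX ^+ (val p).2.

Definition family_algebra : {vspace truncpoly K n} :=
  agenv <<[seq family_generator g | g in min_gens E]>>%VS.

End Subalgebras.

(* Main.v *)
Require Import Defs.
From mathcomp Require Import all_boot all_order all_algebra all_field.
From mathcomp Require Import boolp.

Set Implicit Arguments.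
Unset Strict Implicit.
Unset Printing Implicit Defensive.

Import GRing.Theory.

(** Choose for every atom (minimal generator) g of E an element x^g + ...,
    and multiply them out: a list of atoms of sum s gives a product of
    valuation s.  If two lists of the same sum always gave the same product,
    these products, one for each element of E, would span the generated algebra,
    whose exponent set would then be E.  Two different factorizations s = s' of
    the same element are what can go wrong: the difference of the products has a
    valuation larger than s, which could be a new exponent.

    The bound n <= 10 rules this out.  An element below n with two different
    factorizations into atoms exists only if E contains 2 and 3 or 3, 4 and 5
    (as in 6 = 2+2+2 = 3+3 and 8 = 3+5 = 4+4), and then everything from that
    element on is in E, even in E^(2).  So the difference lies in the span of the
    products of larger valuation, and nothing new appears
    ([unique_factorization], [generator_prod_span]).  This is used through a
    finite check over all submonoids ([exchange_check]), of the one step that an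
    induction on the sum needs: if g + e = g' + e' with distinct atoms g, g',
    then either g' can be taken out of e, or all larger elements are
    decomposable.

    Hence the products form a basis of the generated algebra R
    ([family_algebra_span]).  The products of at least two atoms lie, for the
    same reason, in the span of those with exponent in E^(2), so the exponent set
    of m^2 is E^(2); as the dimension of a subspace of K[x]/x^n is the number of
    its exponents ([dim_exponent_set]), m / m^2 has dimension d(E).

    Conversely let R be a subalgebra with exponent set E.  Gaussian elimination
    gives for each g in E a unique element of R that has coefficient 1 at x^g and
    0 at the other exponents in E ([exists_reduced_element], [reduced_eq0]).  For
    g an atom these are the members of the family.  They generate a subalgebra
    of R with the same exponent set, hence of the same dimension, which is R; and
    by their uniqueness the coefficients are determined by R.

    The recursion defining e_n(E) counts the pairs (g, h) with g an atom and
    h > g outside E, sorted by h ([e_inv_param_count]).  With this closed form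
    the lists are a finite computation ([exponent_table_check]). *)

(** * Submonoids of an initial segment of the natural numbers *)

Section Arithmetic.

Implicit Types (P Q : pred nat) (n s : nat) (l : seq nat).

Definition decomposable P s := has (fun a => P a && P (s - a)) (iota 1 s.-1).

Definition atom P g := [&& 0 < g, P g & ~~ decomposable P g].

(** The sum runs over all s < n in the outer loop, so that the test can be
    evaluated. *)
Definition closed_below n P :=
  P 0 && all (fun s => all (fun a => P a ==> P (s - a) ==> P s) (iota 0 s))
             (iota 0 n).

Definition param_count P n :=
  \sum_(0 <= h < n | ~~ P h) count (atom P) (iota 0 h).

Lemma decomposableP P s :
  reflect (exists a b, [/\ 0 < a, 0 < b, P a, P b & s = a + b])
          (decomposable P s).
Proof.
apply: (iffP hasP) => [[a]|[a [b [a0 b0 Pa Pb ->]]]].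
  rewrite mem_iota => /andP[a0 a_lt] /andP[Pa Pb].
  have a_s : a < s by case: s a_lt {Pb} => [|s] //; rewrite ltnNge a0.
  by exists a, (s - a); rewrite subn_gt0 subnKC // ltnW.
exists a; last by rewrite addKn Pa.
by rewrite mem_iota a0 add1n prednK ?addn_gt0 ?a0 // -[ltnLHS]addn0 ltn_add2l.
Qed.

Lemma eq_decomposable P Q s :
  (forall i, i < s -> P i = Q i) -> decomposable P s = decomposable Q s.
Proof.
have sub P1 P2 : (forall i, i < s -> P1 i = P2 i) ->
    decomposable P1 s -> decomposable P2 s.
  move=> eqP /decomposableP[a [b [a0 b0 Pa Pb def_s]]].
  have a_s : a < s by rewrite def_s -addn1 leq_add2l.
  have b_s : b < s by rewrite def_s -add1n leq_add2r.
  by apply/decomposableP; exists a, b; rewrite -!eqP.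
move=> eqPQ; apply/idP/idP; apply: sub => // i i_s.
by rewrite eqPQ.
Qed.

Lemma eq_atom P Q g :
  (forall i, i <= g -> P i = Q i) -> atom P g = atom Q g.
Proof.
move=> eqPQ; rewrite /atom eqPQ // (@eq_decomposable P Q) // => i i_g.
by rewrite eqPQ // ltnW.
Qed.

Lemma eq_param_count P Q n :
  (forall i, i < n -> P i = Q i) -> param_count P n = param_count Q n.
Proof.
move=> eqPQ; rewrite /param_count [LHS]big_nat_cond [RHS]big_nat_cond.
apply: eq_big => [h|h /andP[/andP[_ h_n] _]].
  by rewrite leq0n /=; case: ltnP => //= h_n; rewrite eqPQ.
apply: eq_in_count => g; rewrite mem_iota => /andP[_ g_h].
by apply: eq_atom => i i_g; rewrite eqPQ // (leq_ltn_trans i_g) // (ltn_trans g_h).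
Qed.

Lemma closed_belowP n P :
  reflect (P 0 /\ forall a b, a + b < n -> P a -> P b -> P (a + b))
          (closed_below n P).
Proof.
apply: (iffP andP) => -[P0 clP]; split=> //.
  move=> a [|b] ab_n Pa Pb; first by rewrite addn0.
  have {clP} := allP clP (a + b.+1); rewrite mem_iota ab_n => /(_ isT) clP.
  have := allP clP a; rewrite mem_iota addKn Pa Pb /=; apply.
  by rewrite -addSnnS leq_addr.
apply/allP => s; rewrite mem_iota => /andP[_ s_n].
apply/allP => a; rewrite mem_iota => /andP[_ a_s].
have {2}<- : a + (s - a) = s by rewrite subnKC // ltnW.
by apply/implyP => Pa; apply/implyP => Pb; apply: clP; rewrite // subnKC // ltnW.
Qed.

Lemma atom_gt0 P g : atom P g -> 0 < g.
Proof. by case/and3P. Qed.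

Lemma atom_mem P g : atom P g -> P g.
Proof. by case/and3P. Qed.

Lemma sum_atoms_mem n P l :
  closed_below n P -> all (atom P) l -> sumn l < n -> P (sumn l).
Proof.
move=> /closed_belowP[P0 clP]; elim: l => //= g l IHl /andP[/atom_mem Pg al] lt_n.
by apply: clP => //; apply: IHl => //; apply: leq_ltn_trans lt_n; rewrite leq_addl.
Qed.

Lemma sum_atoms_decomposable n P l :
  closed_below n P -> all (atom P) l -> 1 < size l -> sumn l < n ->
  decomposable P (sumn l).
Proof.
case: l => // g [//|g' l] clP /= /and3P[ag ag' al] _ lt_n.
apply/decomposableP; exists g, (g' + sumn l).
rewrite (atom_gt0 ag) addn_gt0 (atom_gt0 ag') (atom_mem ag); split=> //.
apply: (@sum_atoms_mem n _ (g' :: l)); rewrite //= ?ag' //.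
by apply: leq_ltn_trans lt_n; rewrite leq_addl.
Qed.

(** Splitting e again and again stops because the parts get smaller. *)
Lemma exists_factorization P e :
  P e -> exists2 l, all (atom P) l & sumn l = e.
Proof.
elim/ltn_ind: e => -[|e] IHe Pe; first by exists [::].
case: (boolP (atom P e.+1)) => [ae|]; first by exists [:: e.+1]; rewrite /= ?ae ?addn0.
rewrite /atom Pe /= negbK => /decomposableP[a [b [a0 b0 Pa Pb def_e]]].
have lt_a : a < e.+1 by rewrite def_e -[ltnLHS]addn0 ltn_add2l.
have lt_b : b < e.+1 by rewrite def_e -[ltnLHS]add0n ltn_add2r.
have [l al sl] := IHe a lt_a Pa; have [l' al' sl'] := IHe b lt_b Pb.
by exists (l ++ l'); rewrite ?all_cat ?al // sumn_cat sl sl'.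
Qed.

(** What the induction step of unique factorization needs, as a finite test: two
    different atoms that can each be taken out of s can be taken out together,
    unless uniqueness at s does not matter. *)
Definition exchange_property n P :=
  all (fun s => all (fun g => all (fun g' =>
    [&& atom P g, atom P g', g != g', P (s - g) & P (s - g')] ==>
      (g' <= s - g) && P (s - g - g') || all (decomposable P) (iota s (n - s)))
    (iota 1 s)) (iota 1 s)) (iota 0 n).

Lemma exchangeP n P g g' e e' :
    exchange_property n P -> atom P g -> atom P g' -> g != g' -> P e -> P e' ->
    g + e = g' + e' -> g + e < n ->
  (g' <= e) && P (e - g') \/ forall h, g + e <= h < n -> decomposable P h.
Proof.
move=> exP ag ag' gg' Pe Pe' eq_s lt_n.
have {exP} := allP exP (g + e); rewrite mem_iota lt_n => /(_ isT) exP.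
have {exP} := allP exP g; rewrite mem_iota (atom_gt0 ag) add1n ltnS leq_addr.
move=> /(_ isT) exP; have {exP} := allP exP g'.
rewrite mem_iota (atom_gt0 ag') add1n ltnS {1}eq_s leq_addr => /(_ isT).
rewrite ag ag' gg' addKn Pe {1}eq_s addKn Pe' /= => /orP[->|]; first by left.
move/allP => dec; right=> h /andP[le_h h_n]; apply: dec.
by rewrite mem_iota le_h subnKC // ltnW.
Qed.

(** By induction on the sum.  If the lists begin with different atoms g and g',
    the exchange property gives a list u such that both tails have the sum of a
    list through u: g' :: u for the first and g :: u for the second.  These sums
    are smaller, so by induction both lists are permutations of g :: g' :: u.  The
    alternative, that everything from some point on is decomposable, passes to
    larger sums. *)
Lemma unique_factorization n P l l' :
    closed_below n P -> exchange_property n P ->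
    all (atom P) l -> all (atom P) l' -> sumn l = sumn l' -> sumn l < n ->
  perm_eq l l' \/ forall h, sumn l <= h < n -> decomposable P h.
Proof.
move=> clP exP.
have [m] := ubnP (sumn l); elim: m l l' => // m IHm [|g l] [|g' l'] //=.
- by left.
- by move=> _ _ /andP[/atom_gt0 g0 _] /(congr1 (leq 1)); rewrite addn_gt0 g0.
- by move=> _ /andP[/atom_gt0 g0 _] _ /(congr1 (leq 1)); rewrite addn_gt0 g0.
move=> le_m /andP[ag al] /andP[ag' al'] eq_s lt_n.
have IH k k' : all (atom P) k -> all (atom P) k' -> sumn k = sumn k' ->
    sumn k < g + sumn l ->
    perm_eq k k' \/ (forall h, g + sumn l <= h < n -> decomposable P h).
  move=> ak ak' eq_k lt_k.
  have [||pk|tail] := IHm _ _ _ ak ak' eq_k.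
  - exact: leq_trans lt_k _.
  - exact: ltn_trans lt_k lt_n.
  - by left.
  by right=> h /andP[le_h h_n]; rewrite tail // h_n (leq_trans (ltnW lt_k)).
have lt_l : sumn l < g + sumn l by rewrite -add1n leq_add2r (atom_gt0 ag).
have lt_l' : sumn l' < g + sumn l by rewrite eq_s -add1n leq_add2r (atom_gt0 ag').
case: (eqVneq g g') => [eq_g|neq_g].
  subst g'; move/eqP: eq_s; rewrite eqn_add2l => /eqP eq_l.
  by case: (IH l l') => //; [rewrite perm_cons; left | right].
have Pl : P (sumn l) by apply: (sum_atoms_mem clP) => //; apply: ltn_trans lt_n.
have Pl' : P (sumn l') by apply: (sum_atoms_mem clP) => //; apply: ltn_trans lt_n.
have [/andP[le_g' /exists_factorization[u au su]]|] :=
  exchangeP exP ag ag' neq_g Pl Pl' eq_s lt_n; last by right.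
have su' : g' + sumn u = sumn l by rewrite su subnKC.
have su'' : g + sumn u = sumn l'.
  by apply/eqP; rewrite -(eqn_add2l g') -eq_s -su' addnCA.
case: (IH l (g' :: u)) => //=; [by rewrite ag'| | by right].
case: (IH l' (g :: u)) => //=; [by rewrite ag | | by right].
move=> pl' pl; left.
rewrite (perm_trans (y := [:: g, g' & u])) ?perm_cons //.
by rewrite perm_sym (perm_trans (y := [:: g', g & u])) ?perm_cons // (perm_catCA [:: g'] [:: g]).
Qed.

(** Submonoids are listed by their positive elements, as in the tables. *)
Definition mem_list l : pred nat := fun i => i \in 0 :: l.

Fixpoint sublists l : seq (seq nat) :=
  if l is x :: l' then sublists l' ++ map (cons x) (sublists l') else [:: [::]].

Lemma filter_sublists P l : filter P l \in sublists l.
Proof.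
elim: l => //= x l IHl; rewrite mem_cat; case: (P x); last by rewrite IHl.
by rewrite map_f ?orbT.
Qed.

Lemma sublists_subset l k : k \in sublists l -> {subset k <= l}.
Proof.
elim: l k => [|x l IHl] k; first by rewrite inE => /eqP->.
rewrite /= mem_cat => /orP[/IHl sub i /sub|]; first by rewrite inE orbC => ->.
move=> /mapP[k' /IHl sub ->] i; rewrite !inE.
by case: (i == x) => //= /sub.
Qed.

Definition submonoid_lists n m :=
  [seq l <- sublists (iota 1 m) | closed_below n (mem_list l)].

(** Some bound on n is necessary: for n = 12 the submonoid generated by 4, 5 and 6
    has 4 + 6 = 5 + 5, but does not contain 11. *)
Lemma exchange_check :
  all (fun n => all (fun l => exchange_property n (mem_list l))
                    (submonoid_lists n n.-1)) (iota 0 11).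
Proof. by vm_compute. Qed.

(** [param_count] without big operators, which do not compute. *)
Definition param_count_list l n :=
  sumn [seq count (atom (mem_list l)) (iota 0 h)
       | h <- iota 0 n & ~~ mem_list l h].

Lemma param_count_listE l n : param_count_list l n = param_count (mem_list l) n.
Proof. by rewrite /param_count_list sumnE big_map big_filter /param_count /index_iota subn0. Qed.

Lemma exponent_table_check n : 1 < n <= 10 ->
  perm_eq (exponent_table n)
          [seq (l, param_count_list l n) | l <- submonoid_lists n n.-2].
Proof.
have: all (fun n => perm_eq (exponent_table n)
   [seq (l, param_count_list l n) | l <- submonoid_lists n n.-2]) (iota 2 9).
  by vm_compute.
by move/allP=> check /andP[n1 n10]; apply: check; rewrite mem_iota n1.
Qed.

End Arithmetic.

(** * Subsets of [0, n-1] and the lists of exponent sets *)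

(** Passing from 'I_n to nat makes the restriction to [0, n-2] invisible and
    turns the notions about E into boolean functions that compute. *)
Definition mem_nat n (E : {set 'I_n}) : pred nat :=
  fun i => i \in [seq val j | j in E].

Section MemNat.

Variable n : nat.
Implicit Types (E : {set 'I_n}) (i : 'I_n).

Lemma mem_nat_ord E i : mem_nat E i = (i \in E).
Proof. by rewrite /mem_nat (mem_image val_inj). Qed.

Lemma mem_nat_lt E (k : nat) : mem_nat E k -> k < n.
Proof. by case/imageP => i _ ->; apply: ltn_ord. Qed.

Lemma mem_nat_inj E E' : mem_nat E =1 mem_nat E' -> E = E'.
Proof. by move=> eqE; apply/setP => i; rewrite -!mem_nat_ord eqE. Qed.

Lemma double_partE E i : (i \in double_part E) = decomposable (mem_nat E) i.
Proof.
rewrite inE; apply/existsP/decomposableP.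
  case=> a /andP[/setIdP[Ea a0]] /existsP[b /andP[/setIdP[Eb b0] /eqP def_i]].
  by exists a, b; rewrite !mem_nat_ord.
case=> a [b [a0 b0 Ea Eb def_i]].
exists (Ordinal (mem_nat_lt Ea)); rewrite inE -mem_nat_ord Ea a0 /=.
apply/existsP; exists (Ordinal (mem_nat_lt Eb)).
by rewrite inE -mem_nat_ord Eb b0 /= def_i.
Qed.

Lemma min_gensE E i : (i \in min_gens E) = atom (mem_nat E) i.
Proof. by rewrite in_setD double_partE inE -mem_nat_ord andbC -andbA andbCA. Qed.

Lemma sub_partial_monoidP E :
  reflect (sub_partial_monoid E) (closed_below n (mem_nat E)).
Proof.
apply: (iffP (closed_belowP _ _)) => [[E0 clE]|[[z Ez z0] clE]]; split.
- by exists (Ordinal (mem_nat_lt E0)); rewrite // -mem_nat_ord.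
- move=> a b c Ea Eb def_c; rewrite -mem_nat_ord def_c.
  by apply: clE; rewrite ?mem_nat_ord // -def_c.
- by rewrite -z0 mem_nat_ord.
move=> a b ab_n Pa Pb; have -> : a + b = Ordinal ab_n by [].
rewrite mem_nat_ord.
apply: (clE (Ordinal (mem_nat_lt Pa)) (Ordinal (mem_nat_lt Pb))) => //.
  by rewrite -mem_nat_ord.
by rewrite -mem_nat_ord.
Qed.

Lemma card_min_gens_lt E h : h <= n ->
  #|[set g in min_gens E | g < h]| = count (atom (mem_nat E)) (iota 0 h).
Proof.
move=> h_n; rewrite -sum1_card -sum1_count.
rewrite -[in iota 0 h](subn0 h) [RHS](big_nat_widen _ _ n) // big_mkord.
by apply: eq_bigl => g; rewrite inE min_gensE.
Qed.

(** The pairs (g, h) are sorted by their second component. *)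
Lemma card_param E : #|{: param E}| = param_count (mem_nat E) n.
Proof.
rewrite card_sig -sum1_card /param_count big_mkord.
rewrite (eq_bigl (fun p => (p.2 \notin E) && (p.1 \in min_gens E) && (p.1 < p.2)));
  last by move=> [g h]; rewrite -[LHS]/(param_index E (g, h)) /param_index andbCA andbA.
rewrite (eq_bigl (fun p : 'I_n * 'I_n => (p.2 \notin E) &&
           (p.1 \in [set g in min_gens E | g < p.2])));
  last by move=> [g h]; rewrite [in RHS]in_set andbA.
rewrite -(pair_big_dep xpredT (fun g h => (h \notin E) && (g \in [set g in min_gens E | g < h])) (fun _ _ => 1)) /=.
rewrite (exchange_big_dep (fun h => h \notin E)) /=; last by move=> ? ? _ /andP[].
rewrite [RHS](eq_bigl (fun h : 'I_n => h \notin E));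
  last by move=> h; rewrite mem_nat_ord.
apply: eq_bigr => h hE; rewrite hE /= sum1_card card_min_gens_lt //.
exact: ltnW.
Qed.

End MemNat.

Lemma mem_nat_drop_max n (E : {set 'I_n.+1}) k :
  mem_nat (drop_max E) k = (k < n) && mem_nat E k.
Proof.
apply/idP/andP => [/imageP[i]|[k_n]].
  by rewrite inE -mem_nat_ord => Ei ->; split; first exact: ltn_ord.
have -> : k = widen_ord (leqnSn n) (Ordinal k_n) by [].
by rewrite mem_nat_ord => Ek; rewrite (mem_nat_ord _ (Ordinal k_n)) inE.
Qed.

Lemma mem_nat_add_max n (E : {set 'I_n}) k :
  mem_nat (add_max E) k = (k == n) || mem_nat E k.
Proof.
apply/imageP/orP => [[i]|[/eqP->|/imageP[i Ei ->]]].
- rewrite !inE => /orP[/eqP->->|]; first by left; rewrite /= eqxx.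
  by move=> /imsetP[j Ej ->] ->; right; rewrite mem_nat_ord.
- by exists ord_max; rewrite ?setU11.
by exists (widen_ord (leqnSn n) i); rewrite // setU1r // imset_f.
Qed.

Lemma mem_nat_of_positives n l : 0 < n -> {subset l <= iota 0 n} ->
  mem_nat (of_positives n l) =1 mem_list l.
Proof.
move=> n0 sub k; apply/imageP/idP => [[i]|lk]; first by rewrite inE => ? ->.
have k_n : k < n.
  move: lk; rewrite /mem_list inE => /orP[/eqP->//|/sub].
  by rewrite mem_iota.
by exists (Ordinal k_n); rewrite // inE.
Qed.

(** The atoms of E other than n-1 are the atoms of its restriction, because
    decomposability of g depends on the elements below g only.  So the step from
    n-1 to n adds the pairs (g, h) with h = n-1; there are d(E) of them if n-1 is
    not in E, since then all atoms are smaller than n-1, and none otherwise. *)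
Lemma e_inv_param_count n (E : {set 'I_n}) : e_inv E = param_count (mem_nat E) n.
Proof.
elim: n E => [|n IHn] E; first by rewrite /param_count big_nil.
have drop_eq i : i < n -> mem_nat (drop_max E) i = mem_nat E i.
  by move=> i_n; rewrite mem_nat_drop_max i_n.
rewrite /param_count big_mkcond big_nat_recr //= -big_mkcond -/(param_count _ _).
rewrite IHn (eq_param_count drop_eq) -mem_nat_ord /=.
case: eqP => [n0|_].
  by subst n; rewrite /param_count big_nil /=; case: ifP.
case: ifPn => nE /=; first by rewrite addn0.
rewrite addnC; congr (_ + _); rewrite -card_min_gens_lt // /min_gen_number.
apply: eq_card => g; rewrite inE; case: (boolP (g \in _)) => //= gE.
rewrite ltn_neqAle -ltnS ltn_ord andbT; case: eqP => // g_max.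
by case/negP: nE; move: gE; rewrite min_gensE => /atom_mem; rewrite g_max.
Qed.

Lemma mem_nat_list n (E : {set 'I_n}) : mem_nat E 0 ->
  mem_nat E = mem_list [seq k <- iota 1 n.-1 | mem_nat E k].
Proof.
move=> E0; apply: funext => k; rewrite /mem_list inE mem_filter mem_iota.
case: eqP => [->//|/eqP k0] /=; case: (boolP (mem_nat E k)) => //= /mem_nat_lt k_n.
by rewrite lt0n k0 add1n prednK // (leq_ltn_trans _ k_n).
Qed.

Lemma sub_partial_monoid_exchange n (E : {set 'I_n}) : n <= 10 ->
  sub_partial_monoid E -> exchange_property n (mem_nat E).
Proof.
move=> n10 /sub_partial_monoidP clE.
have [E0 _] := closed_belowP _ _ clE.
have {}E_list := mem_nat_list E0; rewrite E_list in clE *.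
have {}n10 : n \in iota 0 11 by rewrite mem_iota.
apply: (allP (allP exchange_check n n10)).
by rewrite mem_filter clE filter_sublists.
Qed.

Lemma closed_below_drop_max n (E : {set 'I_n.+1}) : 0 < n ->
  closed_below n.+1 (mem_nat E) -> closed_below n (mem_nat (drop_max E)).
Proof.
move=> n0 /closed_belowP[E0 clE]; apply/closed_belowP.
split=> [|a b ab_n]; rewrite !mem_nat_drop_max ?n0 // ab_n.
by move=> /andP[_ Ea] /andP[_ Eb]; apply: clE => //; apply: ltnW.
Qed.

Lemma closed_below_add_max n (E : {set 'I_n}) :
  closed_below n (mem_nat E) -> closed_below n.+1 (mem_nat (add_max E)).
Proof.
move=> /closed_belowP[E0 clE]; apply/closed_belowP.
split=> [|a b]; rewrite !mem_nat_add_max ?E0 ?orbT //.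
rewrite ltnS leq_eqVlt => /orP[->//|ab_n] /orP[/eqP def_a|Ea].
  by move: ab_n; rewrite def_a ltnNge leq_addr.
case/orP=> [/eqP def_b|Eb]; first by move: ab_n; rewrite def_b ltnNge leq_addl.
by rewrite clE ?orbT.
Qed.

Lemma add_maxK n : cancel (@add_max n) (@drop_max n).
Proof.
move=> E; apply: mem_nat_inj => k; rewrite mem_nat_drop_max mem_nat_add_max.
case: ltngtP => //= n_k; apply/esym/negP => /mem_nat_lt; rewrite ltnNge.
  by rewrite ltnW.
by rewrite n_k leqnn.
Qed.

Lemma drop_maxK n (E : {set 'I_n.+1}) : ord_max \in E -> add_max (drop_max E) = E.
Proof.
rewrite -mem_nat_ord => Emax; apply: mem_nat_inj => k.
rewrite mem_nat_add_max mem_nat_drop_max.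
case: ltngtP => [//|k_n|->] /=; last by rewrite Emax.
by apply/esym/negP => /mem_nat_lt; rewrite ltnS leqNgt k_n.
Qed.

Lemma e_inv_add_max n (E : {set 'I_n}) : 0 < n -> e_inv (add_max E) = e_inv E.
Proof.
move=> n0 /=; rewrite gtn_eqF // -mem_nat_ord mem_nat_add_max eqxx.
by rewrite add_maxK.
Qed.

(** A submonoid that does not contain n-1 is determined by its elements in
    [1, n-2], and [exponent_table_check] went through all subsets of that interval. *)
Lemma exponent_tableP n (E : {set 'I_n}) e : 1 < n <= 10 ->
  reflect [/\ closed_below n (mem_nat E), ~~ mem_nat E n.-1 & e_inv E = e]
    ((E, e) \in [seq (of_positives n t.1, t.2) | t <- exponent_table n]).
Proof.
move=> n_bounds; have /andP[n1 _] := n_bounds; have n0 := ltnW n1.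
have pred_gt0 : 0 < n.-1 by rewrite ltn_predRL.
have pred2 : n.-2.+1 = n.-1 := prednK pred_gt0.
have sub l : l \in submonoid_lists n n.-2 -> {subset l <= iota 1 n.-2}.
  by rewrite mem_filter => /andP[_ /sublists_subset].
have sub0 (l : seq nat) : {subset l <= iota 1 n.-2} -> {subset l <= iota 0 n}.
  move=> sub_l i /sub_l; rewrite !mem_iota add1n pred2 => /andP[_ i_lt].
  by rewrite (leq_trans i_lt) ?leq_pred.
apply: (iffP mapP) => [[t]|[clE nE def_e]].
  rewrite (perm_mem (exponent_table_check n_bounds)) => /mapP[l l_mem -> /=].
  have mem_l := mem_nat_of_positives n0 (sub0 _ (sub _ l_mem)).
  case=> -> ->; rewrite e_inv_param_count param_count_listE (funext mem_l).
  split=> //; first by move: l_mem; rewrite mem_filter => /andP[].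
  rewrite /mem_list inE negb_or -lt0n pred_gt0; apply/negP => /(sub _ l_mem).
  by rewrite mem_iota add1n pred2 ltnn andbF.
have [E0 _] := closed_belowP _ _ clE.
pose l := [seq k <- iota 1 n.-2 | mem_nat E k].
have El : mem_nat E = mem_list l.
  rewrite [LHS]mem_nat_list //; congr mem_list; rewrite /l.
  have -> : iota 1 n.-1 = iota 1 n.-2 ++ [:: n.-1].
    by rewrite -{1}pred2 -(addn1 n.-2) iotaD /= add1n pred2.
  rewrite filter_cat /=.
  by rewrite (negPf nE) cats0.
have l_mem : l \in submonoid_lists n n.-2.
  by rewrite mem_filter -El clE filter_sublists.
exists (l, param_count_list l n).
  by rewrite (perm_mem (exponent_table_check n_bounds)) map_f.
rewrite -def_e e_inv_param_count param_count_listE /= -El; congr (_, _).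
apply: mem_nat_inj => k.
by rewrite (mem_nat_of_positives n0 (sub0 _ (sub _ l_mem))) El.
Qed.

Lemma exponent_listP n (E : {set 'I_n}) e : 0 < n <= 10 ->
  (E, e) \in exponent_list n <-> sub_partial_monoid E /\ e_inv E = e.
Proof.
move=> n_bounds; rewrite (rwP (sub_partial_monoidP E)).
case: n n_bounds E => // n; elim: n e => [|n IHn] e n_bounds E.
  rewrite [exponent_list _]/= inE xpair_eqE; split=> [/andP[/eqP-> /eqP->]|[clE <-]].
    by split=> //; apply/closed_belowP; split=> [|[] // []] //; rewrite (mem_nat_of_positives).
  rewrite eqxx andbT; apply/eqP/mem_nat_inj => k.
  have [E0 _] := closed_belowP _ _ clE.
  by rewrite mem_nat_of_positives // mem_nat_list.
have n1_bounds := ltnW n_bounds.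
rewrite [exponent_list _]/= mem_cat; split=> [/orP[/mapP[[E' e'] E'_mem]|]|].
- case=> -> ->; have [clE' <-] := (IHn _ n1_bounds _).1 E'_mem.
  by rewrite e_inv_add_max //; split=> //; apply: closed_below_add_max.
- by move/exponent_tableP => []; rewrite ?n_bounds.
case=> clE def_e; apply/orP; case: (boolP (mem_nat E n.+1)) => [Emax|nE].
  have Emax' : ord_max \in E by rewrite -mem_nat_ord.
  left; rewrite -(drop_maxK Emax'); apply/mapP; exists (drop_max E, e) => //.
  apply/IHn => //; split; first exact: closed_below_drop_max.
  by rewrite -(e_inv_add_max (drop_max E)) // drop_maxK.
by right; apply/exponent_tableP; rewrite ?n_bounds.
Qed.

(** * Valuations and triangular families in K[x]/x^n *)

Section Truncated.

Local Open Scope ring_scope.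

Variables (K : fieldType) (n : nat).
Hypothesis n_gt0 : (0 < n)%N.
Local Notation T := (truncpoly K n).
Implicit Types (f g : T) (U R : {vspace T}) (A : {set 'I_n}).

Lemma coef_trunc_ge f i : (n <= i)%N -> (f : {poly K})`_i = 0.
Proof.
move=> n_i; apply: big_coef_npoly.
by rewrite mk_monic_Xn size_polyXn prednK.
Qed.

Lemma truncpolyP f g :
  (forall i : 'I_n, (f : {poly K})`_i = (g : {poly K})`_i) -> f = g.
Proof.
move=> eq_fg; apply/npolyP => i; case: (ltnP i n) => [i_n|n_i].
  exact: (eq_fg (Ordinal i_n)).
by rewrite !coef_trunc_ge.
Qed.

Lemma coef_in_qpoly (p : {poly K}) (i : 'I_n) :
  (in_qpoly 'X^n p : {poly K})`_i = p`_i.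
Proof.
rewrite /= mk_monic_Xn prednK // -Pdiv.RingMonic.take_poly_rmodp.
by rewrite coef_take_poly ltn_ord.
Qed.

Lemma coef_truncM f g (i : 'I_n) :
  (f * g : {poly K})`_i = \sum_(j < i.+1) (f : {poly K})`_j * (g : {poly K})`_(i - j).
Proof. by rewrite [LHS]coef_in_qpoly coefM. Qed.

Lemma coef_qXn k (i : 'I_n) : ('qX ^+ k : T) `_i = (i == k :> nat)%:R :> K.
Proof. by rewrite -[_ ^+ k]rmorphXn coef_in_qpoly coefXn. Qed.

(** Divisibility by x^s, stated by coefficients. *)
Definition xdvd s f := forall i, (i < s)%N -> (f : {poly K})`_i = 0.

Definition xmonic s f := xdvd s f /\ (f : {poly K})`_s = 1.

Lemma xdvd_eq0 f s : (n <= s)%N -> xdvd s f -> f = 0.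
Proof.
move=> n_s f0; apply: truncpolyP => i.
by rewrite f0 ?coef0 // (leq_trans _ n_s).
Qed.

Lemma xdvdM s t f g : xdvd s f -> xdvd t g -> xdvd (s + t) (f * g).
Proof.
move=> f0 g0 i i_st; case: (ltnP i n) => [i_n|]; last exact: coef_trunc_ge.
rewrite (coef_truncM f g (Ordinal i_n)) big1 //= => j _.
case: (ltnP j s) => [/f0->|s_j]; first by rewrite mul0r.
rewrite [X in _ * X]g0 ?mulr0 // -subSn ?leq_subLR; last exact: leq_ord.
by apply: leq_trans i_st _; rewrite leq_add2r.
Qed.

Lemma xmonicM s t f g : (s + t < n)%N ->
  xmonic s f -> xmonic t g -> xmonic (s + t) (f * g).
Proof.
move=> st_n [f0 f1] [g0 g1]; split; first exact: xdvdM.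
rewrite (coef_truncM f g (Ordinal st_n)) /=.
have s_lt : (s < (s + t).+1)%N by rewrite ltnS leq_addr.
rewrite (bigD1 (Ordinal s_lt)) //= addKn f1 g1 mulr1 big1 ?addr0 // => j neq_j.
case: (ltnP j s) => [/f0->|s_j]; first by rewrite mul0r.
rewrite [X in _ * X]g0 ?mulr0 // -subSn; last exact: leq_ord.
rewrite leq_subLR ltn_add2r.
by rewrite ltn_neqAle s_j andbT eq_sym.
Qed.

Lemma xmonic1 : xmonic 0 1.
Proof. by split=> //; rewrite coef1. Qed.

Lemma xmonic_neq0 s f : xmonic s f -> f != 0.
Proof.
by case=> _ f1; apply: contra_eq_neq f1 => ->; rewrite coef0 eq_sym oner_neq0.
Qed.

Lemma xdvd_xval s f : f != 0 -> xdvd s f <-> (s <= xval f)%N.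
Proof.
move=> f0; rewrite /xval mup_geq // subr0 /dvdp -Pdiv.IdomainMonic.take_poly_modp.
split=> [fs|/eqP fs i i_s].
  by apply/eqP/polyP => i; rewrite coef_take_poly coef0; case: ltnP => // /fs.
by have := congr1 (fun p : {poly K} => p`_i) fs; rewrite coef_take_poly i_s coef0.
Qed.

Lemma coef_xval f : f != 0 -> (f : {poly K})`_(xval f) != 0.
Proof.
move=> f0; apply/eqP => fv.
have [dvd_f _] := xdvd_xval (xval f).+1 f0.
have [_ dvd_v] := xdvd_xval (xval f) f0.
suff /dvd_f : xdvd (xval f).+1 f by rewrite ltnn.
by move=> i; rewrite ltnS leq_eqVlt => /orP[/eqP->//|]; apply: dvd_v.
Qed.

Lemma exponent_setP U (i : 'I_n) :
  reflect (exists2 f, f \in U & xmonic i f) (i \in exponent_set U).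
Proof.
rewrite inE; apply: (iffP (asboolP _)) => [[f [Uf f0 fi]]|[f Uf [fi f1]]].
  exists (((f : {poly K})`_i)^-1 *: f); first exact: memvZ.
  have fi0 : (f : {poly K})`_i != 0 by rewrite -fi coef_xval.
  split=> [j j_i|]; rewrite coefZ; last by rewrite mulVf.
  have [_ fs] := xdvd_xval (xval f) f0.
  by rewrite (fs (leqnn _) j) ?fi ?mulr0.
have f0 : f != 0 by apply: (@xmonic_neq0 i); split.
exists f; split=> //; apply/eqP; rewrite eqn_leq; apply/andP; split.
  rewrite leqNgt; apply/negP => /(xdvd_xval _ f0)/(_ i (ltnSn i)).
  by move/eqP; rewrite f1 oner_eq0.
exact/(xdvd_xval _ f0).
Qed.

Lemma mem_exponent_set U f (i : 'I_n) :
  f \in U -> xdvd i f -> (f : {poly K})`_i != 0 -> i \in exponent_set U.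
Proof.
move=> Uf f0 fi; apply/exponent_setP; exists (((f : {poly K})`_i)^-1 *: f).
  exact: memvZ.
by split=> [j j_i|]; rewrite coefZ; [rewrite (f0 j) ?mulr0 | rewrite mulVf].
Qed.

Lemma exponent_setS U V : (U <= V)%VS -> exponent_set U \subset exponent_set V.
Proof.
move=> sUV; apply/subsetP => i /exponent_setP[f Uf fi].
by apply/exponent_setP; exists f; rewrite ?(subvP sUV).
Qed.

(** Gaussian elimination from the lowest coefficient upwards: if f has valuation
    s, then s is in A, and f minus a multiple of [F s] has larger valuation.  It
    is used both with U the subspace of interest and s = 0, and with U the whole
    space when A contains everything from s on. *)
Lemma triangular_span U A (F : 'I_n -> T) s f :
    (forall i, i \in A -> F i \in U) -> (forall i, i \in A -> xmonic i (F i)) ->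
    (forall i : 'I_n, (s <= i)%N -> i \in exponent_set U -> i \in A) ->
    f \in U -> xdvd s f ->
  f \in <<[seq F i | i in A]>>%VS.
Proof.
move=> FU Fmon; have [m] := ubnP (n - s)%N; elim: m s f => // m IHm s f le_m sA Uf fs.
case: (ltnP s n) => [s_n|n_s]; last by rewrite (xdvd_eq0 n_s fs) mem0v.
have le_m' : (n - s.+1 < m)%N.
  by rewrite -ltnS (leq_trans _ le_m) // ltnS ltn_sub2l.
have sA' (i : 'I_n) : (s < i)%N -> i \in exponent_set U -> i \in A.
  by move=> s_i; apply: sA; apply: ltnW.
case: (eqVneq (f : {poly K})`_s 0) => [fs0|fs0].
  apply: (IHm s.+1) => // i; rewrite ltnS leq_eqVlt => /orP[/eqP->//|].
  exact: fs.
pose i := Ordinal s_n; have Ai : i \in A.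
  by apply: sA => //; apply: (@mem_exponent_set _ f).
have [Fs Fs1] := Fmon i Ai.
rewrite -[f](subrK ((f : {poly K})`_s *: F i)) memvD //; last first.
  by rewrite memvZ // memv_span // map_f // mem_enum.
apply: (IHm s.+1) => //; first by rewrite memvB // memvZ // FU.
move=> j; rewrite ltnS leq_eqVlt coefB coefZ => /orP[/eqP->|j_s].
  by rewrite Fs1 mulr1 subrr.
by rewrite (fs j) // (Fs j) // mulr0 subrr.
Qed.

(** The element of lowest valuation is not in the span of the others, whose
    coefficients at that place vanish. *)
Lemma free_triangular (r : seq 'I_n) (F : 'I_n -> T) :
    sorted (fun i j : 'I_n => (i < j)%N) r -> (forall i, i \in r -> xmonic i (F i)) ->
  free [seq F i | i <- r].
Proof.
elim: r => [|i r IHr] r_sorted Fmon; first by rewrite nil_free.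
have lt_tr : transitive (fun i j : 'I_n => (i < j)%N) by move=> ? ? ?; apply: ltn_trans.
move: r_sorted; rewrite /= path_sortedE // => /andP[/allP lt_r r_sorted].
rewrite free_cons IHr // ?andbT; last by move=> j rj; apply: Fmon; rewrite inE rj orbT.
apply/negP => /(@coord_span _ _ _ (in_tuple _)) Fi.
have [_ /eqP] := Fmon i (mem_head _ _); rewrite {}Fi.
rewrite poly_of_qpoly_sum coef_sum big1 ?(eq_sym 0) ?oner_eq0 // => k _.
have k_r : (k < size r)%N by rewrite -(size_map F).
rewrite coefZ (nth_map i) //; set j := nth i r k.
have rj : j \in r by rewrite mem_nth.
have [|Fj _] := Fmon j; first by rewrite inE rj orbT.
by rewrite Fj ?mulr0 // lt_r.
Qed.

Lemma dim_triangular A (F : 'I_n -> T) :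
  (forall i, i \in A -> xmonic i (F i)) -> \dim <<[seq F i | i in A]>> = #|A|.
Proof.
move=> Fmon; rewrite cardE -(size_map F); apply/eqP.
rewrite -[_ == _]/(free _); apply: free_triangular => [|i]; last first.
  by rewrite mem_enum; apply: Fmon.
rewrite /(enum _) -enumT; apply: sorted_filter => [? ? ?|]; first exact: ltn_trans.
by have := iota_ltn_sorted 0 n; rewrite -val_enum_ord sorted_map.
Qed.

(** One element for each exponent gives a triangular basis. *)
Lemma dim_exponent_set U : \dim U = #|exponent_set U|.
Proof.
have /choice[F FP] (i : 'I_n) : exists f, i \in exponent_set U -> f \in U /\ xmonic i f.
  case: (boolP (i \in _)) => [/exponent_setP[f Uf fi]|_]; last by exists 0.
  by exists f.
rewrite -(@dim_triangular _ F) => [|i /FP[]//]; congr (\dim _).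
apply: subv_anti; apply/andP; split.
  apply/subvP => f Uf; apply: (@triangular_span U _ _ 0) => // i /FP[] //.
by apply/span_subvP => f /imageP[i /FP[Fi _] ->].
Qed.

Lemma exponent_set_triangular A (F : 'I_n -> T) :
  (forall i, i \in A -> xmonic i (F i)) -> exponent_set <<[seq F i | i in A]>>%VS = A.
Proof.
move=> Fmon; apply/esym/eqP; rewrite eqEcard -dim_exponent_set dim_triangular //.
rewrite leqnn andbT; apply/subsetP => i Ai; apply/exponent_setP; exists (F i).
  by rewrite memv_span // map_f // mem_enum.
exact: Fmon.
Qed.

Lemma eq_exponent_set U V :
  (U <= V)%VS -> exponent_set U = exponent_set V -> U = V.
Proof.
by move=> sUV eqE; apply/eqP; rewrite eqEdim sUV !dim_exponent_set eqE leqnn.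
Qed.

Lemma exponent_setM U V (a b c : 'I_n) : c = (a + b)%N :> nat ->
  a \in exponent_set U -> b \in exponent_set V -> c \in exponent_set (U * V)%VS.
Proof.
move=> def_c /exponent_setP[f Uf fa] /exponent_setP[g Vg gb]; apply/exponent_setP.
exists (f * g); first exact: memv_mul.
by rewrite def_c; apply: xmonicM => //; rewrite -def_c.
Qed.

Lemma sub_partial_monoid_exponent_set R :
  unital_subalgebra R -> sub_partial_monoid (exponent_set R).
Proof.
case/andP=> R1 RR; split.
  by exists (Ordinal n_gt0) => //; apply/exponent_setP; exists 1 => //; apply: xmonic1.
move=> a b c Ra Rb def_c; apply: (subsetP (exponent_setS RR)).
exact: exponent_setM def_c Ra Rb.
Qed.

(** The valuation of f would be an exponent of U, where f has coefficient 0. *)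
Lemma reduced_eq0 U f :
  f \in U -> (forall i, i \in exponent_set U -> (f : {poly K})`_i = 0) -> f = 0.
Proof.
move=> Uf f0; suff fs s : xdvd s f by apply: (xdvd_eq0 (leqnn n)).
elim: s => // s IHs i; rewrite ltnS leq_eqVlt => /orP[/eqP->|]; last exact: IHs.
case: (ltnP s n) => [s_n|]; last exact: coef_trunc_ge.
apply/eqP/negPn/negP => fs0; case/eqP: (fs0).
by apply: (f0 (Ordinal s_n)); apply: mem_exponent_set Uf _ _.
Qed.

(** The coefficients at the exponents are adjusted in increasing order, each by a
    multiple of an element of that valuation, which leaves the earlier ones
    unchanged. *)
Lemma exists_reduction U f : exists2 r, r \in U &
  forall i, i \in exponent_set U -> (r : {poly K})`_i = (f : {poly K})`_i.
Proof.
suff /(_ n)[r Ur rP] k : exists2 r, r \in U & forall i : 'I_n,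
    (i < k)%N -> i \in exponent_set U -> (r : {poly K})`_i = (f : {poly K})`_i.
  by exists r => // i; apply: rP.
elim: k => [|k [r Ur rP]]; first by exists 0; rewrite ?mem0v.
case: (ltnP k n) => [k_n|n_k]; last first.
  by exists r => // i _; apply: rP; apply: leq_trans n_k.
case: (boolP (Ordinal k_n \in exponent_set U)) => [|kU]; last first.
  exists r => // i; rewrite ltnS leq_eqVlt => /orP[/eqP ik|]; last exact: rP.
  by move=> iU; case/negP: kU; have -> : Ordinal k_n = i by apply: val_inj.
case/exponent_setP => u Uu [/= uk uk1].
exists (r + ((f : {poly K})`_k - (r : {poly K})`_k) *: u).
  by rewrite memvD // memvZ.
move=> i; rewrite ltnS leq_eqVlt coefD coefZ => /orP[/eqP->|i_k] iU.
  by rewrite uk1 mulr1 addrC subrK.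
by rewrite uk // mulr0 addr0 rP.
Qed.

(** The reduction of x^g modulo the monomials outside the exponent set.  Its
    coefficients below g vanish: the lowest nonzero one would be at an exponent of
    U different from g, where the coefficients are 0. *)
Lemma exists_reduced_element U (g : 'I_n) : g \in exponent_set U ->
  exists f, [/\ f \in U, xmonic g f &
    forall i, i \in exponent_set U -> (f : {poly K})`_i = (i == g)%:R].
Proof.
move=> Ug; have [r Ur rP] := exists_reduction U ('qX ^+ g).
have {}rP i : i \in exponent_set U -> (r : {poly K})`_i = (i == g)%:R.
  by move=> /rP->; rewrite coef_qXn.
exists r; split=> //; split; last by rewrite rP ?eqxx.
move=> i; have [m] := ubnP i; elim: m i => // m IHm i le_m i_g.
have i_n : (i < n)%N := ltn_trans i_g (ltn_ord g).
case: (boolP (Ordinal i_n \in exponent_set U)) => iU.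
  by rewrite (rP _ iU) -val_eqE /= ltn_eqF.
apply/eqP/negPn/negP => ri; case/negP: iU; apply: (mem_exponent_set Ur) => // j j_i.
by apply: IHm; [apply: leq_trans j_i _ | apply: ltn_trans i_g].
Qed.

Lemma prod_span_sub (X Y : seq T) U :
  (forall x y, x \in X -> y \in Y -> x * y \in U) -> (<<X>> * <<Y>> <= U)%VS.
Proof.
move=> XY; apply/prodvP => u v.
move=> /(@coord_span _ _ _ (in_tuple X))-> /(@coord_span _ _ _ (in_tuple Y))->.
rewrite mulr_suml memv_suml // => i _; rewrite mulr_sumr memv_suml // => j _.
by rewrite -scalerAl -scalerAr !memvZ // XY // mem_nth.
Qed.

End Truncated.

(** * Members of the parametrized families *)

Section FamilyGenerators.

Local Open Scope ring_scope.

Variables (K : fieldType) (n : nat).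
Hypothesis n_gt0 : (0 < n)%N.
Variable E : {set 'I_n}.
Implicit Types (c : {ffun param E -> K}) (g : 'I_n).

Lemma coef_family_generator c g (i : 'I_n) :
  (family_generator c g : {poly K})`_i =
  (i == g)%:R + \sum_(p : param E | (val p).1 == g) c p * ((val p).2 == i)%:R.
Proof.
rewrite /family_generator poly_of_qpolyD coefD coef_qXn //; congr (_ + _).
rewrite poly_of_qpoly_sum coef_sum; apply: eq_bigr => p _.
by rewrite coefZ coef_qXn // eq_sym.
Qed.

Lemma coef_family_generator_param c (p : param E) :
  (family_generator c (val p).1 : {poly K})`_(val p).2 = c p.
Proof.
have /and3P[_ _ p_lt] := valP p.
rewrite coef_family_generator -val_eqE gtn_eqF //= add0r.
rewrite (bigD1 p) //= eqxx mulr1 big1 ?addr0 // => q /andP[/eqP q1 qp].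
case: eqP => [q2|]; last by rewrite mulr0.
case/eqP: qp; apply: val_inj.
by rewrite [val q]surjective_pairing [val p]surjective_pairing q1 q2.
Qed.

Lemma coef_family_generator_small c g (i : 'I_n) :
  (i \in E) || (i <= g)%N -> (family_generator c g : {poly K})`_i = (i == g)%:R.
Proof.
move=> iP; rewrite coef_family_generator big1 ?addr0 // => p /eqP p1.
have /and3P[_ p2 p_lt] := valP p; case: eqP => [p2i|]; last by rewrite mulr0.
by move: iP; rewrite -p2i (negPf p2) /= leqNgt -p1 p_lt.
Qed.

Lemma xmonic_family_generator c g : xmonic g (family_generator c g).
Proof.
split=> [i i_g|]; last by rewrite coef_family_generator_small ?leqnn ?orbT ?eqxx.
have i_n : (i < n)%N := ltn_trans i_g (ltn_ord g).
rewrite (@coef_family_generator_small c g (Ordinal i_n)); last by rewrite (ltnW i_g) orbT.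
by rewrite -val_eqE /= ltn_eqF.
Qed.

Lemma family_generator_in c g : g \in min_gens E -> family_generator c g \in family_algebra c.
Proof.
by move=> gE; apply: (subvP (sub_agenv _)); rewrite memv_span // map_f // mem_enum.
Qed.

Lemma unital_family_algebra c : unital_subalgebra (family_algebra c).
Proof. by rewrite /unital_subalgebra /family_algebra agenvM subvv memvE sub1_agenv. Qed.

Lemma family_algebra_inj c c' : exponent_set (family_algebra c) = E ->
  family_algebra c = family_algebra c' -> c = c'.
Proof.
move=> defE eq_fam; apply/ffunP => p; have /and3P[p1 _ _] := valP p.
rewrite -!coef_family_generator_param; congr ((_ : {poly K})`_ _); congr val.
apply/eqP; rewrite -subr_eq0; apply/eqP.
apply: (@reduced_eq0 _ _ n_gt0 (family_algebra c)).
  by rewrite memvB ?family_generator_in // eq_fam family_generator_in.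
move=> i; rewrite defE => iE.
by rewrite coefB !coef_family_generator_small ?iE // subrr.
Qed.

(** The reduced element of R at g is x^g plus terms above g and outside E; the
    coefficients of these terms serve as parameters. *)
Lemma exists_family_in (R : {vspace truncpoly K n}) : exponent_set R = E ->
  exists c, forall g, g \in min_gens E -> family_generator c g \in R.
Proof.
move=> defE.
have /choice[f fP] (g : 'I_n) : exists f : truncpoly K n, g \in E ->
    [/\ f \in R, xmonic g f & forall i, i \in E -> (f : {poly K})`_i = (i == g)%:R].
  case: (boolP (g \in E)) => [|_]; last by exists 0.
  by rewrite -{1}defE => /(exists_reduced_element n_gt0)[f]; rewrite defE; exists f.
pose c := [ffun p : param E => (f (val p).1 : {poly K})`_(val p).2].
exists c => g gE.
have [|Rf [f_low f_lead] f_red] := fP g.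
  by move: gE; rewrite min_gensE => /atom_mem; rewrite mem_nat_ord.
rewrite (_ : family_generator c g = f g) //; apply: truncpolyP => // i.
case: (boolP ((i \in E) || (i <= g)%N)) => [iP|].
  rewrite coef_family_generator_small //; case/orP: iP => [/f_red->//|].
  rewrite leq_eqVlt => /orP[/eqP/val_inj->|i_g]; first by rewrite eqxx f_lead.
  by rewrite f_low // -val_eqE ltn_eqF.
rewrite negb_or -ltnNge => /andP[iE g_i].
have gi : param_index E (g, i) by apply/and3P.
have := coef_family_generator_param c (exist _ (g, i) gi).
by rewrite ffunE.
Qed.

End FamilyGenerators.

(** * Products of generators *)

Section Monomials.

Local Open Scope ring_scope.

Variables (K : fieldType) (n : nat).
Hypothesis n_gt0 : (0 < n)%N.
Variables (E : {set 'I_n}) (c : {ffun param E -> K}).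
Implicit Type l : seq nat.

Local Notation atoms := (all (atom (mem_nat E))).

(** Lists of atoms are lists of natural numbers; the value outside [0, n-1] is
    never met. *)
Definition generator_at (k : nat) : truncpoly K n :=
  oapp (family_generator c) 0 (insub k).

Definition generator_prod l : truncpoly K n := \prod_(k <- l) generator_at k.

Lemma atom_ord k : atom (mem_nat E) k -> exists2 g : 'I_n, g \in min_gens E & k = g.
Proof.
move=> ak; have k_n := mem_nat_lt (atom_mem ak).
by exists (Ordinal k_n); rewrite // min_gensE.
Qed.

Lemma generator_at_ord (g : 'I_n) : generator_at g = family_generator c g.
Proof. by rewrite /generator_at valK. Qed.

Lemma generator_prod_cat l l' :
  generator_prod (l ++ l') = generator_prod l * generator_prod l'.
Proof. exact: big_cat. Qed.

Lemma generator_prod_cons k l :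
  generator_prod (k :: l) = generator_at k * generator_prod l.
Proof. exact: big_cons. Qed.

Lemma xdvd_generator_prod l : atoms l -> xdvd (sumn l) (generator_prod l).
Proof.
elim: l => [|k l IHl] //= /andP[/atom_ord[g _ ->] al].
rewrite generator_prod_cons generator_at_ord.
by apply: xdvdM => //; [case: (xmonic_family_generator n_gt0 c g) | apply: IHl].
Qed.

Lemma xmonic_generator_prod l : atoms l -> (sumn l < n)%N ->
  xmonic (sumn l) (generator_prod l).
Proof.
elim: l => [_ _|k l IHl] /=; first by rewrite /generator_prod big_nil; apply: xmonic1.
case/andP=> /atom_ord[g _ ->] al lt_n.
rewrite generator_prod_cons generator_at_ord.
apply: xmonicM => //; first exact: xmonic_family_generator.
by apply: IHl => //; apply: leq_ltn_trans lt_n; apply: leq_addl.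
Qed.

Lemma generator_prod_in l : atoms l -> generator_prod l \in family_algebra c.
Proof.
have /andP[one_in mul_in] := unital_family_algebra c.
elim: l => [|k l IHl] /=; first by rewrite /generator_prod big_nil.
case/andP=> /atom_ord[g gE ->] /IHl l_in.
rewrite generator_prod_cons generator_at_ord (subvP mul_in) // memv_mul //.
exact: family_generator_in.
Qed.

Lemma generator_prod_perm l l' : perm_eq l l' -> generator_prod l = generator_prod l'.
Proof. by move=> pl; apply: perm_big. Qed.

Hypothesis closedE : closed_below n (mem_nat E).
Hypothesis exchangeE : exchange_property n (mem_nat E).

Lemma exists_generator_basis : exists F : 'I_n -> truncpoly K n,
  forall i, i \in E -> exists l, [/\ atoms l, sumn l = i & F i = generator_prod l].
Proof.
have /choice[F FP] (i : 'I_n) : exists f, i \in E ->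
    exists l, [/\ atoms l, sumn l = i & f = generator_prod l].
  case: (boolP (i \in E)) => [|_]; last by exists 0.
  rewrite -mem_nat_ord => /exists_factorization[l al sl].
  by exists (generator_prod l) => _; exists l.
by exists F.
Qed.

Section Basis.

Variable F : 'I_n -> truncpoly K n.
Hypothesis FP : forall i, i \in E ->
  exists l, [/\ atoms l, sumn l = i & F i = generator_prod l].

Lemma xmonic_basis i : i \in E -> xmonic i (F i).
Proof.
by move=> /FP[l [al sl ->]]; rewrite -sl; apply: xmonic_generator_prod; rewrite ?sl.
Qed.

(** The only place where factorizations are compared.  If that of l is the chosen
    one up to order, the product is a basis element.  Otherwise A contains the
    whole range from the sum of l on, and all elements divisible by that power of x
    are in the span.  It is applied with A = E to find R and with A = E^(2) to
    find m^2. *)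
Lemma generator_prod_span (A : {set 'I_n}) l :
    double_part E \subset A -> A \subset E ->
    (forall i : 'I_n, val i = sumn l -> i \in A) -> atoms l ->
  generator_prod l \in <<[seq F i | i in A]>>%VS.
Proof.
move=> sDA /subsetP sAE lA al; case: (ltnP (sumn l) n) => [lt_n|]; last first.
  by move=> n_le; rewrite (xdvd_eq0 n_gt0 n_le (xdvd_generator_prod al)) mem0v.
have Ai := lA (Ordinal lt_n) (erefl _); have [l' [al' sl' Fi]] := FP (sAE _ Ai).
have [/generator_prod_perm->|tail] :=
  unique_factorization closedE exchangeE al al' (esym sl') lt_n.
  by rewrite -Fi memv_span // map_f // mem_enum.
apply: (@triangular_span _ _ n_gt0 fullv _ _ (sumn l)); rewrite ?memvf //.
- by move=> i _; apply: memvf.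
- by move=> i /sAE; apply: xmonic_basis.
- move=> i le_i _; apply: (subsetP sDA); rewrite double_partE.
  by apply: tail; rewrite le_i ltn_ord.
exact: xdvd_generator_prod.
Qed.

Lemma double_part_sub : double_part E \subset E.
Proof.
apply/subsetP => i; rewrite double_partE -mem_nat_ord => /decomposableP[a [b [_ _ Ea Eb def_i]]].
have [_ clE] := closed_belowP _ _ closedE.
by rewrite def_i; apply: clE; rewrite // -def_i.
Qed.

Lemma family_algebra_span : family_algebra c = <<[seq F i | i in E]>>%VS.
Proof.
have prod_in l : atoms l -> generator_prod l \in <<[seq F i | i in E]>>%VS.
  move=> al; apply: generator_prod_span => //; first exact: double_part_sub.
  move=> i def_i; rewrite -mem_nat_ord def_i.
  by apply: (sum_atoms_mem closedE); rewrite // -def_i; apply: ltn_ord.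
apply: subv_anti; apply/andP; split.
  apply: agenv_sub_modl.
    by rewrite -memvE; have := prod_in [::] isT; rewrite /generator_prod big_nil.
  apply: prod_span_sub => _ _ /imageP[g gE ->] /imageP[i /FP[l [al _ ->]] ->].
  rewrite -generator_at_ord -generator_prod_cons; apply: prod_in.
  by rewrite /= al andbT -min_gensE.
by apply/span_subvP => _ /imageP[i /FP[l [al _ ->]] ->]; apply: generator_prod_in.
Qed.

Lemma exponent_set_family : exponent_set (family_algebra c) = E.
Proof.
by rewrite family_algebra_span exponent_set_triangular // => i; apply: xmonic_basis.
Qed.

Lemma exponent_set_max_ideal :
  exponent_set (max_ideal (family_algebra c)) = positive_part E.
Proof.
apply/setP => i; rewrite [RHS]inE.
have -> : (i \in E) = (i \in exponent_set (family_algebra c)).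
  by rewrite exponent_set_family.
apply/exponent_setP/andP => [[f]|[/exponent_setP[f Rf fi] i0]].
  rewrite mem_max_ideal => /andP[Rf /eqP f0] fi; split.
    by apply/exponent_setP; exists f.
  rewrite lt0n; apply/eqP => i0; case: fi => _ /eqP.
  by rewrite i0 f0 eq_sym oner_eq0.
exists f => //; rewrite mem_max_ideal Rf.
by case: fi => fi _; rewrite fi ?eqxx.
Qed.

Lemma max_ideal_span :
  max_ideal (family_algebra c) = <<[seq F i | i in positive_part E]>>%VS.
Proof.
have F_pos i : i \in positive_part E -> xmonic i (F i).
  by rewrite inE => /andP[/xmonic_basis].
apply/esym; apply: (eq_exponent_set n_gt0).
  apply/span_subvP => _ /imageP[i iE ->]; rewrite mem_max_ideal.
  have [Fi _] := F_pos i iE; move: iE; rewrite inE => /andP[iE i0].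
  rewrite Fi // eqxx andbT; have [l [al _ ->]] := FP iE.
  exact: generator_prod_in.
by rewrite exponent_set_max_ideal exponent_set_triangular.
Qed.

(** m^2 is spanned by products of two basis elements, that is by products of at
    least two generators, of which the sum is decomposable. *)
Lemma exponent_set_max_ideal_sqr :
  exponent_set (max_ideal (family_algebra c) * max_ideal (family_algebra c))%VS
  = double_part E.
Proof.
apply/eqP; rewrite eqEsubset; apply/andP; split; last first.
  apply/subsetP => i; rewrite inE => /existsP[a /andP[aE /existsP[b /andP[bE /eqP def_i]]]].
  by apply: (exponent_setM n_gt0 def_i); rewrite exponent_set_max_ideal.
have spanD : exponent_set <<[seq F i | i in double_part E]>>%VS = double_part E.
  apply: exponent_set_triangular => // i /(subsetP double_part_sub).
  exact: xmonic_basis.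
rewrite -spanD; apply: exponent_setS; rewrite max_ideal_span; apply: prod_span_sub.
move=> _ _ /imageP[a aE ->] /imageP[b bE ->].
have [Ea a0] : a \in E /\ (0 < a)%N by apply/andP; move: aE; rewrite inE.
have [Eb b0] : b \in E /\ (0 < b)%N by apply/andP; move: bE; rewrite inE.
have [l [al sl ->]] := FP Ea; have [l' [al' sl' ->]] := FP Eb.
rewrite -generator_prod_cat; apply: generator_prod_span => //.
- exact: double_part_sub.
- move=> i; rewrite sumn_cat sl sl' => def_i; rewrite double_partE def_i.
  by apply/decomposableP; exists a, b; rewrite !mem_nat_ord.
by rewrite all_cat al.
Qed.

Lemma thin_family : thin (family_algebra c).
Proof.
rewrite /thin exponent_set_family /cotangent_dim !(dim_exponent_set n_gt0).
rewrite exponent_set_max_ideal exponent_set_max_ideal_sqr.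
rewrite /min_gen_number /min_gens cardsD (setIidPr _) //.
apply/subsetP => i iD; rewrite inE (subsetP double_part_sub) //=.
move: iD; rewrite double_partE => /decomposableP[a [b [a0 _ _ _ ->]]].
by rewrite addn_gt0 a0.
Qed.

End Basis.

End Monomials.

(** * The classification for n at most 10 *)

Section SmallLength.

Variables (K : fieldType) (n : nat).
Hypotheses (n_gt0 : 0 < n) (n_le10 : n <= 10).
Variable E : {set 'I_n}.
Hypothesis monE : sub_partial_monoid E.

Lemma exponent_set_family_algebra (c : {ffun param E -> K}) :
  exponent_set (family_algebra c) = E.
Proof.
have clE := introT (sub_partial_monoidP E) monE.
have exE := sub_partial_monoid_exchange n_le10 monE.
have [F FP] := exists_generator_basis c.
exact: exponent_set_family FP.
Qed.

Lemma thin_family_algebra (c : {ffun param E -> K}) : thin (family_algebra c).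
Proof.
have clE := introT (sub_partial_monoidP E) monE.
have exE := sub_partial_monoid_exchange n_le10 monE.
have [F FP] := exists_generator_basis c.
exact: thin_family FP.
Qed.

(** The family with the coefficients of R generates a subalgebra of R that has the
    same exponent set, hence the same dimension. *)
Lemma subalgebra_family (R : {vspace truncpoly K n}) :
  unital_subalgebra R -> exponent_set R = E ->
  exists c : {ffun param E -> K}, R = family_algebra c.
Proof.
case/andP=> R1 RR defE; have [c genR] := exists_family_in n_gt0 defE.
exists c; apply/esym; apply: (eq_exponent_set n_gt0); last first.
  by rewrite exponent_set_family_algebra.
apply: agenv_sub_modl; first by rewrite -memvE.
apply: subv_trans RR; apply: prodvSl; apply/span_subvP => _ /imageP[g gE ->].
exact: genR.
Qed.

End SmallLength.

Lemma exponent_set_eq0 (K : fieldType) n (n_gt0 : 0 < n) (R : {vspace truncpoly K n}) :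
  unital_subalgebra R -> exponent_set R = [set i : 'I_n | val i == 0] <-> R = 1%VS.
Proof.
case/andP=> R1 _.
have set0E : [set i : 'I_n | val i == 0] = [set Ordinal n_gt0].
  by apply/setP => i; rewrite !inE.
have one_sub : [set Ordinal n_gt0] \subset exponent_set R.
  rewrite sub1set; apply/exponent_setP; exists 1%R => //.
  exact: xmonic1.
rewrite set0E; split=> [defR|R_1].
  apply/esym/eqP; rewrite eqEdim -memvE R1 (dim_exponent_set n_gt0) defR cards1.
  by rewrite dimv1.
apply/esym/eqP; rewrite eqEcard one_sub -(dim_exponent_set n_gt0) R_1.
by rewrite dimv1 cards1.
Qed.

Theorem theorem2 (K : fieldType) (n : nat) (n_gt0 : 0 < n) (n_le10 : n <= 10) :
  [/\ (forall (E : {set 'I_n}) (e : nat),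
         (E, e) \in exponent_list n <->
         sub_partial_monoid E /\ e_inv E = e),
      (forall E : {set 'I_n}, sub_partial_monoid E ->
         [/\ (forall R : {vspace truncpoly K n},
                unital_subalgebra R /\ exponent_set R = E <->
                exists c : {ffun param E -> K}, R = family_algebra c),
             #|{: param E}| = e_inv E
           & injective (fun c : {ffun param E -> K} => family_algebra c)]),
      (forall R : {vspace truncpoly K n}, unital_subalgebra R ->
         exponent_set R = [set i : 'I_n | val i == 0] <-> R = 1%VS)
    & (forall R : {vspace truncpoly K n}, unital_subalgebra R -> thin R)].
Proof.
split.
- by move=> E e; apply: exponent_listP; rewrite n_gt0.
- move=> E monE; split.
  + move=> R; split=> [[algR defE]|[c ->]]; first exact: subalgebra_family.
    by split; [apply: unital_family_algebra | apply: exponent_set_family_algebra].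
  + by rewrite card_param e_inv_param_count.
  + move=> c c'; apply: (family_algebra_inj n_gt0).
    exact: exponent_set_family_algebra.
- by move=> R; apply: exponent_set_eq0.
move=> R algR; have monR := sub_partial_monoid_exponent_set n_gt0 algR.
have [c ->] := subalgebra_family n_gt0 n_le10 monR algR (erefl _).
exact: thin_family_algebra.
Qed.
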